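(* Let $K$ be an infinite integral domain and let $n\ge 1$. Equip $M_n(K)$ with the canonical $\mathbb{Z}$-grading. Then the set $C_{\mathbb{Z}}(M_n(K))$ of $\mathbb{Z}$-graded central polynomials of $M_n(K)$ is equal to the $T_{\mathbb{Z}}$-space of $K\langle X\rangle$ generated by the following polynomials, where $z_1,z_2$ and the $x_i$ are variables in $\bigcup_{i\in\mathbb{Z}}X_i$: (12) $z_1(x_1x_2-x_2x_1)z_2$, where $\alpha(x_1)=\alpha(x_2)=0$; (13) $z_1(x_1x_2x_3-x_3x_2x_1)z_2$, where $\alpha(x_1)=-\alpha(x_2)=\alpha(x_3)\neq 0$; (14) $z_1x_1z_2$, where $|\alpha(x_1)|\ge n$; (15) $\sum_{\sigma\in H_n}x_{\sigma(1)}\cdots x_{\sigma(n)}$, where $(\overline{\alpha(x_1)},\dots,\overline{\alpha(x_n)})$ is a complete sequence of $\mathbb{Z}_n$ and $|\alpha(x_i)|<n$ for all $i$.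
   Context: Canonical $\mathbb{Z}$-grading of $M_n(K)$: the matrix unit $e_{ij}$ has degree $j-i\in\mathbb{Z}$. $X=\bigcup_{g\in \mathbb{Z}}X_g$ is a disjoint union of countably infinite sets and $K\langle X\rangle$ is the free (unital) associative $K$-algebra on $X$. A variable $x\in X_g$ has degree $\alpha(x)=g$, and the degree of a monomial is the sum of the degrees of its letters; $K\langle X\rangle_g$ is the $K$-span of monomials of degree $g$. A graded endomorphism $\phi$ of $K\langle X\rangle$ satisfies $\phi(K\langle X\rangle_g)\subset K\langle X\rangle_g$ for all $g$. A $T_{\mathbb{Z}}$-space is a graded $K$-submodule of $K\langle X\rangle$ invariant under all graded endomorphisms; the $T_{\mathbb{Z}}$-space generated by a set is the intersection of all $T_{\mathbb{Z}}$-spaces containing it. A polynomial $f(x_1,\dots,x_m)\in K\langle X\rangle$ is a $\mathbb{Z}$-graded central polynomial of $A=M_n(K)$ if $f(0,\dots,0)=0$ and $f(a_1,\dots,a_m)$ lies in the centre $Z(A)$ for all $a_i\in A_{\alpha(x_i)}$; $C_{\mathbb{Z}}(A)$ is the set of all of them. $H_n$ is the subgroup of $S_n$ generated by the cycle $(1\,2\cdots n)$. For $a\in\mathbb{Z}$, $\overline a$ is its class in $\mathbb{Z}_n$. A sequence $(\gamma_1,\dots,\gamma_n)$ of elements of $\mathbb{Z}_n$ is a complete sequence if $\gamma_1+\cdots+\gamma_n=0$ and $\{\gamma_1,\gamma_1+\gamma_2,\dots,\gamma_1+\cdots+\gamma_n\}=\mathbb{Z}_n$.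
   Formalization: For n = 1 the equality fails, since x_1 ↦ 1 in (15) puts 1 in the T_Z-space although 1 does not vanish at 0; for n = 1 the theorem proved is C_Z(M_1(K)) = (generated T_Z-space) ∩ {f : f(0,…,0)=0}. For n ≥ 2 the equality is as stated. *)

(* Defs.v *)
From mathcomp Require Import all_boot all_order all_algebra all_fingroup.
From mathcomp Require Import finmap.
From mathcomp Require Import boolp classical_sets functions cardinality.
From mathcomp.multinomials Require Import monalg.

Set Implicit Arguments.
Unset Strict Implicit.
Unset Printing Implicit Defensive.

Import GRing.Theory Num.Theory.
Local Open Scope classical_set_scope.
Local Open Scope ring_scope.

(* Throughout, matrices have order [n.+1], so that the index [n : nat] covers
   exactly the orders that are at least 1. *)

(* The variable [(g, k)] is the [k]-th element of the set X_g. *)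
Definition var : choiceType := (int * nat)%type.

Definition alpha (x : var) : int := x.1.

Definition mon_alpha (m : {fmonom var}) : int := \sum_(x <- m) alpha x.

(* The algebra of the free monoid on the variables. *)
Notation freeAlg K := {malg K[{fmonom var}]}.

Definition hvar (K : idomainType) (x : var) : freeAlg K := << fmu x >>.

Definition homogeneous (K : idomainType) (g : int) : set (freeAlg K) :=
  [set f | forall m, m \in msupp f -> mon_alpha m = g].

Definition hcomp (K : idomainType) (g : int) (f : freeAlg K) : freeAlg K :=
  \sum_(m <- msupp f | mon_alpha m == g) << f@_m *g m >>.

Definition graded_endo (K : idomainType)
    (phi : {lrmorphism freeAlg K -> freeAlg K}) : Prop :=
  forall g, phi @` homogeneous g `<=` homogeneous g.

Record TZspace (K : idomainType) (V : set (freeAlg K)) : Prop := {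
  TZspace0 : V 0;
  TZspaceD : forall f g, V f -> V g -> V (f + g);
  TZspaceZ : forall (c : K) f, V f -> V (c *: f);
  TZspace_graded : forall g f, V f -> V (hcomp g f);
  TZspace_endo : forall phi : {lrmorphism freeAlg K -> freeAlg K},
    graded_endo phi -> forall f, V f -> V (phi f)
}.

Definition TZspace_generated (K : idomainType) (G : set (freeAlg K)) :
  set (freeAlg K) := smallest (@TZspace K) G.

(* The span of the matrix units e_ij with j - i = g. *)
Definition mx_component (K : idomainType) (n : nat) (g : int) :
    set 'M[K]_n.+1 :=
  [set a | forall i j : 'I_n.+1, a i j != 0 -> (j : nat)%:Z - (i : nat)%:Z = g].

(* The value of [f] when every variable [x] is replaced by [v x]. *)
Definition eval (K : idomainType) (n : nat) (v : var -> 'M[K]_n.+1)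
    (f : freeAlg K) : 'M[K]_n.+1 :=
  mmap (@scalar_mx K n.+1) (fun m : {fmonom var} => \prod_(x <- m) v x) f.

Definition zero_at_zero (K : idomainType) (n : nat) : set (freeAlg K) :=
  [set f | eval (fun _ => 0 : 'M[K]_n.+1) f = 0].

Definition central_polynomials (K : idomainType) (n : nat) :
    set (freeAlg K) :=
  [set f | zero_at_zero n f /\
    forall v : var -> 'M[K]_n.+1, (forall x, mx_component (alpha x) (v x)) ->
      forall b : 'M[K]_n.+1, eval v f * b = b * eval v f].

(* The class of an integer in Z/(n+1), whose underlying type is ['I_n.+1];
   the notation ['Z_n.+1] is avoided as it denotes Z/2 when [n = 0]. *)
Definition residue (n : nat) (a : int) : 'I_n.+1 := inZp `|(a %% n.+1%:Z)%Z|.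

Definition complete_sequence (n : nat) (gamma : 'I_n.+1 -> 'I_n.+1) : Prop :=
  \sum_i gamma i = 0 /\
  [set \sum_(i < n.+1 | (i <= k)%N) gamma i | k in [set: 'I_n.+1]]
    = [set: 'I_n.+1].

(* [ordS] maps [i] to [i + 1] modulo [n.+1], i.e. it is the cycle (1 2 ... n+1)
   on indices shifted to start at 0. *)
Definition Hgroup (n : nat) : {set 'S_n.+1} :=
  <[perm (@ordS_inj n.+1)]>%g.

Section Generators.
Variables (K : idomainType) (n : nat).
Local Notation "''x_' x" := (hvar K x) (at level 8, x at level 2).

Definition commutator_gens : set (freeAlg K) :=
  [set f | exists z1 z2 x1 x2 : var,
    [/\ uniq [:: z1; z2; x1; x2], alpha x1 = 0, alpha x2 = 0
      & f = 'x_z1 * ('x_x1 * 'x_x2 - 'x_x2 * 'x_x1) * 'x_z2]].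

Definition reversal_gens : set (freeAlg K) :=
  [set f | exists z1 z2 x1 x2 x3 : var,
    [/\ uniq [:: z1; z2; x1; x2; x3],
        alpha x1 = - alpha x2, - alpha x2 = alpha x3, alpha x3 != 0
      & f = 'x_z1 * ('x_x1 * 'x_x2 * 'x_x3 - 'x_x3 * 'x_x2 * 'x_x1) * 'x_z2]].

Definition large_degree_gens : set (freeAlg K) :=
  [set f | exists z1 z2 x1 : var,
    [/\ uniq [:: z1; z2; x1], n.+1%:Z <= `|alpha x1|
      & f = 'x_z1 * 'x_x1 * 'x_z2]].

Definition cyclic_gens : set (freeAlg K) :=
  [set f | exists x : 'I_n.+1 -> var,
    [/\ injective x, complete_sequence (fun i => residue n (alpha (x i))),
        forall i, `|alpha (x i)| < n.+1%:Z
      & f = \sum_(s in Hgroup n) \prod_(i < n.+1) 'x_(x (s i))]].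

Definition central_gens : set (freeAlg K) :=
  commutator_gens `|` reversal_gens `|` large_degree_gens `|` cyclic_gens.

End Generators.

(* Main.v *)
From HB Require Import structures.
Require Import Defs.
From mathcomp Require Import all_boot all_order all_algebra all_fingroup.
From mathcomp Require Import finmap.
From mathcomp Require Import boolp classical_sets functions cardinality.
From mathcomp.multinomials Require Import monalg.
From mathcomp Require Import zify.

Set Implicit Arguments.
Unset Strict Implicit.
Unset Printing Implicit Defensive.

Import Order.TTheory GRing.Theory Num.Theory.
Local Open Scope classical_set_scope.
Local Open Scope ring_scope.

(** A word x_1 ... x_k, read from a vertex p of the integers, is the walk p,
    p + alpha(x_1), p + alpha(x_1) + alpha(x_2), ..., whose edges are the pairs
    (letter, source).  Multiplying graded matrices follows such walks: the
    (i, j) entry of the value of a word is the product of the matrix entries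
    along the edges of its walk from i if this walk stays in {0, ..., n} and
    ends at j, and is 0 otherwise ([word_entry]).  The value of a word is thus
    governed by the multiset of edges of its walk, and the theorem becomes a
    statement on Eulerian trails.

    The generators take scalar values.  The two sides of a commutator or of a reversal
    have the same edges, and a letter of large degree evaluates to 0.  In a
    cyclic generator the rotations of the word are one and the same closed walk
    with n + 1 different starting points.  Completeness says that its vertices
    are distinct modulo n + 1, so that only one translate of the walk can stay
    in {0, ..., n}; that translate then visits every vertex once, and each
    diagonal place receives the same product from exactly one rotation
    ([cyclic_sum_scalar]).  Scalar-valued polynomials form a TZ-space
    ([scalar_valued_TZspace]), and for order at least 2 so do those that also
    vanish at 0 ([central_TZspace]).  For order 1 the cyclic generators are the
    variables of degree 0, which a graded endomorphism may send to 1; this is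
    why vanishing at 0 is a separate condition there.

    Conversely, let V be the TZ-space generated.  Two words with the same
    edges are Eulerian trails of one multigraph from one vertex, and such
    trails are connected by commutator and reversal moves
    ([same_edges_shuffle]); their difference lies in V.  A word whose walk
    stays in {0, ..., n} from no starting point contains a subword of large
    degree ([invalid_infix]), hence lies in V.  Now let f be central.
    Over an infinite domain distinct multisets of edges give linearly
    independent functions of the matrix entries
    ([vanishing_coefficients]).  Once the differences and
    the large-degree words above are used up, each word m of f that is left
    contributes to some entry a monomial that cannot cancel.  This entry is
    diagonal, and the monomial appears in all diagonal entries.  As f has no
    constant term, the edges of m then form a nonempty closed trail through
    all n + 1 vertices, and f contains a trail on these edges from each
    vertex.  Cutting one of them at the first visits of the vertices exhibits
    the sum of these n + 1 trails, up to shuffles, as a substitution instance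
    of a cyclic generator ([closed_walks_generated]).  In every case an element of V
    supported on words of f removes a word of f ([generated_part]), and the
    number of words decreases. *)

(** * Words as walks on the integers *)

Section Trails.

Implicit Types (u v w : seq var) (p q : int).

Definition deg w : int := \sum_(x <- w) alpha x.

Lemma deg_nil : deg [::] = 0. Proof. exact: big_nil. Qed.
Lemma deg_cons x w : deg (x :: w) = alpha x + deg w.
Proof. exact: big_cons. Qed.
Lemma deg_cat u v : deg (u ++ v) = deg u + deg v.
Proof. exact: big_cat. Qed.

Definition degE := (deg_cat, deg_cons, deg_nil).

Fixpoint edges p w : seq (var * int) :=
  if w is x :: w' then (x, p) :: edges (p + alpha x) w' else [::].

Definition target (e : var * int) : int := e.2 + alpha e.1.

Lemma edges_cat p u v : edges p (u ++ v) = edges p u ++ edges (p + deg u) v.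
Proof.
elim: u p => [|x u IH] p /=; first by rewrite deg_nil addr0.
by rewrite IH deg_cons addrA.
Qed.

Lemma edges_shift p q w :
  edges (p + q) w = [seq (e.1, e.2 + q) | e <- edges p w].
Proof.
elim: w p => //= x w IH p; congr cons.
by rewrite -IH; congr edges; lia.
Qed.

Lemma size_edges p w : size (edges p w) = size w.
Proof. by elim: w p => //= x w IH p; rewrite IH. Qed.

Lemma edgesP p w e : reflect
  (exists u v, w = u ++ e.1 :: v /\ e.2 = p + deg u) (e \in edges p w).
Proof.
apply: (iffP idP) => [|[u [v [-> e2]]]]; last first.
  by rewrite edges_cat mem_cat -e2 /= [e]surjective_pairing mem_head orbT.
elim: w p => //= x w IH p; rewrite inE => /orP[/eqP->|/IH[u [v [-> ->]]]].
  by exists [::], w; rewrite deg_nil addr0.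
by exists (x :: u), v; rewrite deg_cons addrA.
Qed.

Lemma perm_edges_shift p q u v :
  perm_eq (edges p u) (edges p v) -> perm_eq (edges q u) (edges q v).
Proof.
have -> : q = p + (q - p) by lia.
by rewrite !edges_shift; apply: perm_map.
Qed.

Lemma deg_rot k w : deg (rot k w) = deg w.
Proof. by apply: perm_big; rewrite perm_rot. Qed.

Lemma target_take p w k : (k < size w)%N ->
  exists2 e, e \in edges p w & target e = p + deg (take k.+1 w).
Proof.
move=> lt_k; pose x := nth (0, 0%N) w k.
exists (x, p + deg (take k w)).
  apply/edgesP; exists (take k w), (drop k.+1 w).
  by rewrite -drop_nth ?cat_take_drop.
by rewrite (take_nth (0, 0%N)) // -cats1 !degE addr0 addrA.
Qed.

(** Translating a nonempty finite multiset of edges changes the sum of their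
    sources. *)
Lemma edges_start_inj p q w :
  w != [::] -> perm_eq (edges p w) (edges q w) -> p = q.
Proof.
move=> w0 pq; have sum_shift : \sum_(e <- edges p w) e.2 =
    \sum_(e <- edges q w) e.2 + (p - q) *+ size w.
  have -> : p = q + (p - q) by lia.
  rewrite edges_shift big_map big_split /= big_const_seq count_predT size_edges.
  by rewrite iter_addr_0 addrAC subrr add0r.
move: sum_shift; rewrite (perm_big _ pq) /= -[LHS]addr0 => /addrI/esym/eqP.
by rewrite mulrn_eq0 size_eq0 (negbTE w0) subr_eq0 => /eqP.
Qed.

(** Rotating a closed walk only moves its starting point. *)
Lemma edges_rot p k w : deg w = 0 ->
  perm_eq (edges (p + deg (take k w)) (rot k w)) (edges p w).
Proof.
move=> w0; have := deg_cat (take k w) (drop k w).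
rewrite cat_take_drop w0 => kw.
rewrite -[X in perm_eq _ (edges p X)](cat_take_drop k w) /rot !edges_cat.
have -> : p + deg (take k w) + deg (drop k w) = p by lia.
by rewrite perm_catC.
Qed.

(** The moves that the commutator and reversal generators allow on words; the
    factors are arbitrary subwords of the required degrees. *)
Inductive shuffle : seq var -> seq var -> Prop :=
| shuffle_refl w : shuffle w w
| shuffle_trans v u w : shuffle u v -> shuffle v w -> shuffle u w
| shuffle_swap a u v b : deg u = 0 -> deg v = 0 ->
    shuffle (a ++ u ++ v ++ b) (a ++ v ++ u ++ b)
| shuffle_rev a u v w b : deg u = - deg v -> deg w = - deg v ->
    deg v != 0 -> shuffle (a ++ u ++ v ++ w ++ b) (a ++ w ++ v ++ u ++ b).

Lemma shuffle_cons x u v : shuffle u v -> shuffle (x :: u) (x :: v).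
Proof.
elim=> [w|v' u' w _ IH1 _ IH2|a u' v' b u0 v0|a u' v' w b uv wv v0].
- exact: shuffle_refl.
- exact: shuffle_trans IH1 IH2.
- exact: (shuffle_swap (x :: a)).
- exact: (shuffle_rev (x :: a)).
Qed.

(** If u1 goes from a vertex p to q, u2 back from q to p, and v again from p to
    q, then u1 and v can be exchanged around u2.  When p = q the three arcs are
    closed walks, and the exchange is obtained by commuting them. *)
Lemma shuffle_arcs u1 u2 v w : deg (u1 ++ u2) = 0 -> deg v = deg u1 ->
  shuffle (u1 ++ u2 ++ v ++ w) (v ++ u2 ++ u1 ++ w).
Proof.
rewrite deg_cat => u0 vu; have [u20|u2n0] := eqVneq (deg u2) 0; last first.
  by apply: (@shuffle_rev [::]) => //; lia.
apply: shuffle_trans (v ++ u1 ++ u2 ++ w) _ _ _ _.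
  have := @shuffle_swap [::] (u1 ++ u2) v w.
  by rewrite /= -!catA deg_cat; apply; lia.
by apply: shuffle_swap; lia.
Qed.

Lemma edges_arcs p u1 u2 v w : deg (u1 ++ u2) = 0 -> deg v = deg u1 ->
  perm_eq (edges p (u1 ++ u2 ++ v ++ w)) (edges p (v ++ u2 ++ u1 ++ w)).
Proof.
rewrite deg_cat => u0 vu; rewrite !edges_cat vu.
have -> : p + deg u1 + deg u2 = p by lia.
by apply/seq.permP => P; rewrite !count_cat; lia.
Qed.

(** By induction along the walk: each edge that starts outside S also ends
    outside S. *)
Lemma walk_avoids (S : pred int) p w : ~~ S p ->
  (forall e, e \in edges p w -> ~~ S e.2 -> ~~ S (target e)) ->
  forall e, e \in edges p w -> ~~ S e.2.
Proof.
elim: w p => //= x w IH p Sp tS e.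
rewrite inE => /orP[/eqP->//|]; apply: IH => [|e' we'].
  exact: (tS (x, p) (mem_head _ _)).
by apply: tS; rewrite inE we' orbT.
Qed.

(** The exchange step for Eulerian trails.  The edge b leaving p occurs in w, so
    w = u b w2 with u a closed walk at p.  If b w2 comes back to a vertex of u,
    the part of b w2 up to that vertex is parallel to the initial part of u,
    and exchanging the two brings b to the front.  Otherwise all
    edges entering the vertices of u belong to u; then the trail b v, having
    left p along b, can never return to p to use the edges of u. *)
Lemma trail_head p b w v : perm_eq (edges p w) (edges p (b :: v)) ->
  exists w', shuffle w (b :: w') /\ perm_eq (edges p w) (edges p (b :: w')).
Proof.
move=> wv; have /edgesP[u [w2 [/= wE pu]]] : (b, p) \in edges p w.
  by rewrite (perm_mem wv) mem_head.
have u0 : deg u = 0 by lia.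
case: u => [|a u] in wE pu u0 *.
  by exists w2; rewrite wE; split=> //; apply: shuffle_refl.
have [[u1 [u2 [w21 [w22 [uE w2E tE]]]]]|avoid] :=
  EM (exists u1 u2 w21 w22, [/\ a :: u = u1 ++ u2, w2 = w21 ++ w22
        & deg (b :: w21) = deg u1]).
  exists (w21 ++ u2 ++ u1 ++ w22).
  have -> : w = u1 ++ u2 ++ (b :: w21) ++ w22 by rewrite wE uE w2E -!catA.
  rewrite uE in u0; split; first exact: (@shuffle_arcs _ _ (b :: w21)).
  exact: (@edges_arcs _ _ _ (b :: w21)).
pose S q := q \in [seq e.2 | e <- edges p (a :: u)].
(* What is left of both trails when the edge b at p is removed. *)
have wE2 : perm_eq (edges p (a :: u) ++ edges (p + alpha b) w2)
                    (edges (p + alpha b) v).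
  rewrite -(perm_cons (b, p)); apply: perm_trans wv.
  rewrite wE edges_cat u0 addr0; apply/seq.permP => P.
  by rewrite /= !count_cat /=; lia.
have Sarc w21 w22 : w2 = w21 ++ w22 -> ~~ S (p + deg (b :: w21)).
  move=> w2E; apply/negP => /mapP[e /edgesP[u1 [u2 [uE ->]]] pE].
  by apply: avoid; exists u1, (e.1 :: u2), w21, w22; split=> //; lia.
suff: ~~ S p by rewrite /S /= inE eqxx.
apply: (@walk_avoids S (p + alpha b) v _ _ (a, p)).
- by have := Sarc [::] w2 erefl; rewrite !degE addr0.
- move=> e; rewrite -(perm_mem wE2) mem_cat => /orP[ue|].
    by case/negP; apply/mapP; exists e.
  case/edgesP=> w21 [w22 [w2E eE]] _.
  rewrite /target eE.
  have := Sarc (w21 ++ [:: e.1]) w22; rewrite -catA => /(_ w2E).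
  by rewrite !degE addr0 !addrA.
- by rewrite -(perm_mem wE2) mem_head.
Qed.

(** Two Eulerian trails of the same multigraph from the same vertex are related
    by shuffles: bring the first edge of the second trail to the front of the
    first one, and continue with the remaining edges. *)
Theorem same_edges_shuffle p u v :
  perm_eq (edges p u) (edges p v) -> shuffle u v.
Proof.
elim: v u p => [|b v IH] u p uv.
  have := perm_size uv; rewrite !size_edges => /size0nil->.
  exact: shuffle_refl.
have [u' [uu' puu']] := trail_head uv.
apply: shuffle_trans uu' (shuffle_cons _ _); apply: (IH _ (p + alpha b)).
rewrite -(perm_cons (b, p)) -[_ :: _]/(edges p (b :: u')).
by rewrite (perm_trans _ uv) // perm_sym.
Qed.

End Trails.

(** * Walks confined to an interval *)

Section Validity.
Implicit Types (u v w : seq var) (p q : int).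

Variable n : nat.

Definition in_range p := (0 <= p) && (p < n.+1%:Z).

Definition valid p w := in_range p && all (in_range \o target) (edges p w).

Lemma in_range_ord p : in_range p -> exists i : 'I_n.+1, p = i%:Z.
Proof.
by case/andP; case: p => // k _ lt_kn; exists (Ordinal (lt_kn : k < n.+1)%N).
Qed.

Lemma ord_in_range (i : 'I_n.+1) : in_range i%:Z.
Proof. by rewrite /in_range ltz_nat ltn_ord. Qed.

Lemma perm_valid p u v :
  perm_eq (edges p u) (edges p v) -> valid p u = valid p v.
Proof. by move=> uv; rewrite /valid (perm_all _ uv). Qed.

Lemma valid_source p w e : valid p w -> e \in edges p w -> in_range e.2.
Proof.
elim: w p => //= x w IH p /and3P[p_in px_in all_in].
rewrite inE => /orP[/eqP->//|]; apply: IH.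
exact/andP.
Qed.

Lemma valid_end p w : valid p w -> in_range (p + deg w).
Proof.
case/lastP: w => [|w x]; first by rewrite deg_nil addr0 => /andP[].
case/andP=> _ /allP; rewrite -cats1 edges_cat => /(_ (x, p + deg w)).
by rewrite mem_cat mem_head orbT /target /= !degE addr0 addrA => /(_ isT).
Qed.

(** If all subwords have degree of absolute value at most n, the vertices of the
    walk lie in an interval of n + 1 integers, and translating the lowest of
    them to 0 makes the walk stay in {0, ..., n}. *)
Lemma invalid_infix w : (forall p, ~~ valid p w) ->
  exists a u b, w = a ++ u ++ b /\ n.+1%:Z <= `|deg u|.
Proof.
move=> inval; apply: contrapT => no_infix.
pose d (i : 'I_(size w).+1) := deg (take i w).
have close i j : `|d i - d j| < n.+1%:Z.
  have wlog_close (i' j' : 'I_(size w).+1) :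
      (i' <= j')%N -> `|d j' - d i'| < n.+1%:Z.
    move=> le_ij; rewrite ltNge; apply/negP => big.
    apply: no_infix; exists (take i' w), (drop i' (take j' w)), (drop j' w).
    have wE : take i' w ++ drop i' (take j' w) = take j' w.
      by rewrite -[in RHS](cat_take_drop i' (take j' w)) take_takel.
    rewrite catA wE cat_take_drop; split=> //.
    suff -> : deg (drop i' (take j' w)) = d j' - d i' by [].
    by rewrite /d -[in RHS]wE deg_cat; lia.
  by case: (leqP i j) => [/wlog_close|/ltnW/wlog_close]; rewrite // distrC.
(* The lowest vertex is reached after i letters. *)
have [i _ imin] := @Order.TotalTheory.arg_minP _ int _ ord0 xpredT d isT.
have dmin j : in_range (d j - d i).
  by rewrite /in_range; move: (close j i) (imin j isT); lia.
case/negP: (inval (- d i)); apply/andP; split.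
  by have := dmin ord0; rewrite /d take0 deg_nil sub0r.
apply/allP => e /edgesP[u [v [wE eE]]] /=; rewrite /target eE.
have lt_u : ((size u).+1 < (size w).+1)%N.
  by rewrite wE size_cat /= !addnS ltnS leq_addr.
have := dmin (Ordinal lt_u).
rewrite /d /= {1}wE -cat1s catA take_size_cat ?size_cat ?addn1 //.
by rewrite degE !degE addr0 [_ - _]addrC addrA.
Qed.

End Validity.

(** * Cutting a walk at the first visits of its vertices *)

Section Blocks.
Implicit Types (w : seq var) (ys : seq (seq var)) (p : int).

Fixpoint starts p ys : seq int :=
  if ys is y :: ys' then p :: starts (p + deg y) ys' else [::].

Lemma starts_rcons p ys y :
  starts p (rcons ys y) = rcons (starts p ys) (p + deg (flatten ys)).
Proof.
elim: ys p => [|z ys IH] p /=; first by rewrite deg_nil addr0.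
by rewrite IH deg_cat addrA.
Qed.

Lemma size_starts p ys : size (starts p ys) = size ys.
Proof. by elim: ys p => //= y ys IH p; rewrite IH. Qed.

Lemma nth_starts x0 p ys k : (k < size ys)%N ->
  nth x0 (starts p ys) k = p + deg (flatten (take k ys)).
Proof.
elim: ys p k => // y ys IH p [|k] /=; first by rewrite deg_nil addr0.
by rewrite ltnS => /IH->; rewrite deg_cat addrA.
Qed.

(** A new block is opened each time the walk leaves a vertex for the first
    time; any other letter is appended to the current block, which does not
    affect where the blocks begin. *)
Lemma first_visit_blocks p w : exists ys, [/\ flatten ys = w,
  uniq (starts p ys) & starts p ys =i [seq e.2 | e <- edges p w]].
Proof.
elim/last_ind: w => [|w x [ys [ysw ys_uniq ysE]]]; first by exists [::].
have edgesE : edges p (rcons w x) = rcons (edges p w) (x, p + deg w).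
  by rewrite -cats1 edges_cat cats1.
have [seen|new] := boolP (p + deg w \in starts p ys); last first.
  exists (rcons ys [:: x]); split; first by rewrite flatten_rcons ysw cats1.
    by rewrite starts_rcons ysw rcons_uniq new.
  by move=> q; rewrite starts_rcons ysw edgesE map_rcons !mem_rcons !inE ysE.
case/lastP: ys => // zs z in ysw ys_uniq ysE seen *.
exists (rcons zs (rcons z x)); split.
- by rewrite -ysw !flatten_rcons -cats1 catA cats1.
- by move: ys_uniq; rewrite !starts_rcons.
- move=> q; move: (ysE q); rewrite edgesE map_rcons mem_rcons inE => <-.
  rewrite !starts_rcons in seen *.
  by case: eqP => // ->; rewrite seen.
Qed.

End Blocks.

(** * Linear independence of monomial functions *)

Section Independence.

(** Dedekind's independence of characters over a domain, in a form where equal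
    characters are grouped: the coefficients of the characters equal to chi0
    sum to 0.  As in Artin's argument, a character chi j other than chi0 is
    eliminated by subtracting chi j b times the relation from its translate by
    b, where b separates chi j from chi0. *)
Lemma independent_characters (K : idomainType) (M : Type) (op : M -> M -> M)
    (one : M) (I : eqType) (chi : I -> M -> K) (chi0 : M -> K) (P : pred I)
    (chiM : forall i a b, chi i (op a b) = chi i a * chi i b)
    (chi1 : forall i, chi i one = 1)
    (chiP : forall i, P i -> chi i =1 chi0)
    (chiNP : forall i, ~~ P i -> exists b, chi i b != chi0 b)
    (s : seq I) (c : I -> K) :
  (forall a, \sum_(i <- s) c i * chi i a = 0) -> \sum_(i <- s | P i) c i = 0.
Proof.
have [k] := ubnP (count (predC P) s); elim: k s c => // k IH s c lt_sk sum0.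
have [/hasP[j js Pj]|/hasPn allP] := boolP (has (predC P) s); last first.
  rewrite -[RHS](sum0 one) [in RHS]big_mkcond /= big_mkcond.
  rewrite big_seq [RHS]big_seq.
  by apply: eq_bigr => i /allP/negPn->; rewrite chi1 mulr1.
have [b jb] := chiNP j Pj.
pose Q i := chi i b != chi j b.
have : \sum_(i <- [seq i <- s | Q i] | P i) c i * (chi i b - chi j b) = 0.
  apply: IH => [|a].
    rewrite -ltnS; apply: leq_trans lt_sk.
    rewrite ltnS -[X in (_ < X)%N]size_filter.
    rewrite -(count_predC Q) -[X in (X < _)%N]addn0 !count_filter.
    rewrite (eq_count (a2 := predI Q (predC P))) => [|i]; last exact: andbC.
    rewrite ltn_add2l -has_count; apply/hasP; exists j => //=.
    by move: Pj => /= ->; rewrite /Q eqxx.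
  rewrite big_filter big_mkcond /=.
  transitivity (\sum_(i <- s) c i * chi i (op b a)
                - chi j b * \sum_(i <- s) c i * chi i a); last first.
    by rewrite !sum0 mulr0 subrr.
  rewrite mulr_sumr -sumrB; apply: eq_bigr => i _; rewrite chiM.
  rewrite /Q; case: eqVneq => [->|_] /=.
    by rewrite mulrCA subrr.
  by rewrite mulrBr mulrBl !mulrA [chi j b * _]mulrC.
rewrite big_filter_cond => sum0'; apply/eqP.
have jb' : chi0 b - chi j b != 0 by rewrite subr_eq0 eq_sym.
rewrite -(mulrI_eq0 _ (mulfI jb')) mulr_sumr; apply/eqP.
apply: etrans sum0'; apply: eq_big => [i|i Pi]; last first.
  by rewrite (chiP i Pi) mulrC.
by rewrite /Q andbC; have [/chiP->|//] := boolP (P i); rewrite eq_sym jb.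
Qed.

Lemma infinite_nonroot (K : idomainType) (p : {poly K}) :
  infinite_set [set: K] -> p != 0 -> exists t, ~~ root p t.
Proof.
move=> K_inf p0; apply: contrapT => /forallNP allroot.
have [B _ sizeB] := infinite_set_fset (size p) K_inf.
have rootB : all (root p) B by apply/allP => t _; apply/negPn/negP/allroot.
by have := max_poly_roots p0 rootB (fset_uniq B); rewrite ltnNge sizeB.
Qed.

(** A polynomial function that vanishes identically on an infinite domain has
    zero coefficients; a monomial is a list of variables up to permutation.
    Monomials are characters of the multiplicative monoid of valuations, and
    two of them that differ in the exponent of e are separated by a valuation
    that is t at e and 1 elsewhere. *)
Lemma vanishing_coefficients (K : idomainType) (T I : eqType)
    (K_inf : infinite_set [set: K]) (s : seq I) (c : I -> K)
    (E : I -> seq T) (E0 : seq T) :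
  (forall a : T -> K, \sum_(i <- s) c i * \prod_(e <- E i) a e = 0) ->
  \sum_(i <- s | perm_eq (E i) E0) c i = 0.
Proof.
apply: (independent_characters (op := fun a b e => a e * b e)
  (one := fun=> 1) (chi0 := fun a => \prod_(e <- E0) a e)).
- by move=> i a b; rewrite big_split.
- by move=> i; rewrite big1.
- by move=> i iE0 a; apply: perm_big.
- move=> i /allPn[e _ /= ne].
  pose p : {poly K} := 'X^(count_mem e (E i)) - 'X^(count_mem e E0).
  have p0 : p != 0.
    apply/eqP => /(congr1 (fun q : {poly K} => q`_(count_mem e E0))) /eqP.
    rewrite coefB !coefXn eqxx [_ == count_mem e (E i)]eq_sym.
    by rewrite (negbTE ne) coef0 sub0r oppr_eq0 oner_eq0.
  have [t] := infinite_nonroot K_inf p0.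
  rewrite /root /p !hornerE subr_eq0 => tne.
  pose a (e' : T) := if e' == e then t else 1.
  have aE u : \prod_(e' <- u) a e' = t ^+ count_mem e u.
    by rewrite /a -big_mkcond big_const_seq -Monoid.iteropE.
  by exists a; rewrite !aE.
Qed.

End Independence.

(** * Evaluation at graded matrices *)

Section Evaluation.
Variables (K : idomainType) (n : nat).
Implicit Types (f g : freeAlg K) (v : var -> 'M[K]_n.+1) (w : seq var).

Definition word w : freeAlg K := << FMonom w >>.

Lemma word_cat u w : word (u ++ w) = word u * word w.
Proof.
rewrite /word malgM_def fgmulUU mulr1; congr << _ >>.
by apply/eqP; rewrite fmP fmM.
Qed.

Lemma word_nil : word [::] = 1.
Proof. by congr << _ >>; apply/eqP; rewrite fmP fm1. Qed.

Lemma word1 x : word [:: x] = hvar K x.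
Proof. by rewrite /hvar; congr << _ >>; apply/eqP; rewrite fmP fmU. Qed.

Lemma word_flatten (ys : seq (seq var)) :
  word (flatten ys) = \prod_(y <- ys) word y.
Proof.
elim: ys => [|y ys IH]; first by rewrite big_nil word_nil.
by rewrite big_cons -IH -word_cat.
Qed.

Lemma scale_word (c : K) w : c *: word w = << c *g FMonom w >>.
Proof. by rewrite -mul_malgC /word malgM_def fgmulUU mulr1 mul1m. Qed.

Lemma malg_words f : f = \sum_(m <- msupp f) f@_m *: word m.
Proof.
by rewrite [LHS]monalgE; apply: eq_bigr => m _; rewrite scale_word fmK.
Qed.

Lemma evalE v f : eval v f = \sum_(m <- msupp f) f@_m *: \prod_(x <- m) v x.
Proof. by apply: eq_bigr => m _; rewrite -mul_scalar_mx. Qed.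

Lemma eval0 v : eval v 0 = 0.
Proof. exact: mmap0. Qed.

Lemma evalD v f g : eval v (f + g) = eval v f + eval v g.
Proof. exact: mmapD. Qed.

Lemma evalB v f g : eval v (f - g) = eval v f - eval v g.
Proof. exact: mmapB. Qed.

Lemma eval_sum v (I : Type) (r : seq I) (P : pred I) (F : I -> freeAlg K) :
  eval v (\sum_(i <- r | P i) F i) = \sum_(i <- r | P i) eval v (F i).
Proof. exact: (raddf_sum (mmap (@scalar_mx K n.+1) _)). Qed.

Lemma eval_monomial v c (m : {fmonom var}) :
  eval v << c *g m >> = c *: \prod_(x <- m) v x.
Proof. by rewrite /eval mmapU -mul_scalar_mx. Qed.

Lemma eval_word v w : eval v (word w) = \prod_(x <- w) v x.
Proof. by rewrite eval_monomial scale1r. Qed.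

Lemma eval_hvar v x : eval v (hvar K x) = v x.
Proof. by rewrite -word1 eval_word big_seq1. Qed.

Lemma evalZ v c f : eval v (c *: f) = c *: eval v f.
Proof.
rewrite [in LHS](malg_words f) scaler_sumr eval_sum evalE scaler_sumr.
apply: eq_bigr => m _.
by rewrite (scalerA c f@_m (word m)) scale_word fmK eval_monomial scalerA.
Qed.

Lemma evalM v f g : eval v (f * g) = eval v f * eval v g.
Proof.
rewrite malgME eval_sum [eval v f]evalE mulr_suml; apply: eq_bigr => k _.
rewrite eval_sum [eval v g]evalE mulr_sumr; apply: eq_bigr => l _.
by rewrite eval_monomial fmM big_cat /= -scalerAl -scalerAr scalerA.
Qed.

Lemma eval1 v : eval v 1 = 1.
Proof. by rewrite -word_nil eval_word big_nil. Qed.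

Lemma eval_endo v (phi : {lrmorphism freeAlg K -> freeAlg K}) f :
  eval v (phi f) = eval (fun x => eval v (phi (hvar K x))) f.
Proof.
rewrite [in LHS](malg_words f) linear_sum eval_sum evalE.
apply: eq_bigr => m _; rewrite linearZ evalZ; congr (_ *: _).
elim: (m : seq var) => [|x w IH].
  by rewrite word_nil rmorph1 eval1 big_nil.
by rewrite -cat1s word_cat rmorphM evalM IH big_cons word1.
Qed.

Definition graded_valuation v := forall x, mx_component (alpha x) (v x).

(** The graded matrix whose entries are the weights of the edges labelled x;
    every graded valuation has this form. *)
Definition weighted_mx (a : var * int -> K) (x : var) : 'M[K]_n.+1 :=
  \matrix_(i, j) if i%:Z + alpha x == j%:Z then a (x, i%:Z) else 0.

Lemma weighted_graded a : graded_valuation (weighted_mx a).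
Proof.
move=> x i j; rewrite mxE.
by case: ifP => [/eqP<- _|]; rewrite ?eqxx // addrC addKr.
Qed.

Lemma graded_weighted v : graded_valuation v -> exists a, v = weighted_mx a.
Proof.
move=> v_gr; exists (fun e => v e.1 (inord `|e.2|) (inord `|target e|)).
apply: funext => x; apply/matrixP => i j; rewrite mxE /target /=.
case: eqP => [->|ne]; first by rewrite !absz_nat !inord_val.
by apply/eqP; apply: contraTT isT => /v_gr; lia.
Qed.

(** From the row i, the matrix of x only leads to the column i + alpha x, so the
    sum over intermediate indices reduces to the single walk spelled by w. *)
Lemma word_entry a w i j : (\prod_(x <- w) weighted_mx a x) i j =
  if valid n i%:Z w && (i%:Z + deg w == j%:Z)
  then \prod_(e <- edges i%:Z w) a e else 0.
Proof.
elim: w i => [|x w IH] i.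
  rewrite !big_nil deg_nil addr0 /valid ord_in_range mxE eqz_nat val_eqE.
  by case: eqP.
rewrite big_cons mxE /= big_cons.
have [x_in|x_out] := boolP (in_range n (i%:Z + alpha x)); last first.
  rewrite /valid /= /target /= (negbTE x_out) andbF.
  rewrite big1 // => k _; rewrite mxE; case: eqP => [ik|_].
    by case/negP: x_out; rewrite ik ord_in_range.
  exact: mul0r.
have [k kE] := in_range_ord x_in.
rewrite (bigD1 k) //= [X in _ + X]big1 => [|l lk]; last first.
  by rewrite mxE kE eqz_nat val_eqE eq_sym (negbTE lk) mul0r.
rewrite addr0 mxE kE eqxx IH /valid /= !ord_in_range /target /= kE ord_in_range.
by rewrite deg_cons addrA kE; case: ifP => // _; rewrite mulr0.
Qed.

Lemma eval_entry a f i j : eval (weighted_mx a) f i j =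
  \sum_(m <- msupp f) f@_m *
    (if valid n i%:Z m && (i%:Z + deg m == j%:Z)
     then \prod_(e <- edges i%:Z m) a e else 0).
Proof.
rewrite evalE summxE; apply: eq_bigr => m _.
by rewrite mxE word_entry.
Qed.

(** Words of degree d contribute only to the entries with j - i = d. *)
Lemma eval_hcomp v d f i j : graded_valuation v ->
  eval v (hcomp d f) i j = if j%:Z - i%:Z == d then eval v f i j else 0.
Proof.
move=> /graded_weighted[a ->].
rewrite /hcomp eval_sum summxE eval_entry big_mkcond /=.
have termE m :
    (if mon_alpha m == d
     then eval (weighted_mx a) << f@_m *g m >> i j else 0) =
    if deg m == d then f@_m *
      (if valid n i%:Z m && (i%:Z + deg m == j%:Z)
       then \prod_(e <- edges i%:Z m) a e else 0) else 0.
  have -> : mon_alpha m = deg m by [].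
  by rewrite eval_monomial mxE word_entry.
case: (eqVneq _ d) => [jid|jid].
  apply: eq_bigr => m _; rewrite termE; case: (eqVneq (deg m) d) => // md.
  by case: ifP => [/andP[_ /eqP]|_]; [lia | rewrite mulr0].
rewrite big1 // => m _; rewrite termE; case: (eqVneq (deg m) d) => // md.
by case: ifP => [/andP[_ /eqP]|_]; [lia | rewrite mulr0].
Qed.

Lemma central_scalarP (A : 'M[K]_n.+1) :
  (forall B, A * B = B * A) <-> exists c, A = c%:M.
Proof.
split=> [A_central|[c ->] B]; last by rewrite -!mulmxE scalar_mxC.
exists (A 0 0); apply/matrixP => i j; rewrite mxE.
have := congr1 (fun B : 'M_n.+1 => B i 0) (A_central (delta_mx j 0)).
rewrite !mxE (bigD1 j) //= big1 ?addr0 => [|k /negbTE kj]; last first.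
  by rewrite mxE kj /= mulr0.
rewrite (bigD1 0) //= big1 ?addr0 => [|k /negbTE kj]; last first.
  by rewrite mxE kj andbF mul0r.
rewrite !mxE !eqxx andbT mulr1 => ->; case: (i == j); rewrite ?mul1r ?mul0r //.
Qed.

End Evaluation.

(** * Sums over the cyclic group *)

Section CyclicSum.

Lemma cycle_perm_expE n k (i : 'I_n.+1) :
  ((perm (@ordS_inj n.+1) ^+ k)%g i : nat) = ((i + k) %% n.+1)%N.
Proof.
elim: k => [|k IH]; first by rewrite expg0 perm1 addn0 modn_small.
by rewrite expgSr permM permE /= IH -addn1 modnDml addn1 addnS.
Qed.

Lemma modn_shift i n k :
  ((i + ((n + k) %% n.+1).+1) %% n.+1 = (i + k) %% n.+1)%N.
Proof.
rewrite -addSnnS modnDmr.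
have -> : (i.+1 + (n + k) = n.+1 + (i + k))%N by lia.
exact: modnDl.
Qed.

Lemma sum_Hgroup (R : nzRingType) (T : Type) (n : nat) (x : 'I_n.+1 -> T)
    (F : T -> R) :
  \sum_(s in Hgroup n) \prod_(i < n.+1) F (x (s i)) =
  \sum_(k < n.+1) \prod_(z <- rot k.+1 (codom x)) F z.
Proof.
pose c := perm (@ordS_inj n.+1).
(* c ^+ k.+1 sends the last index n to k, hence is determined by that image. *)
rewrite (reindex_onto (fun k : 'I_n.+1 => c ^+ k.+1)%g
  (fun s : 'S_n.+1 => s ord_max)) /=; last first.
  move=> s /cycleP[k ->]; apply/permP => i; apply/val_inj.
  by rewrite /= !cycle_perm_expE /= modn_shift.
apply: eq_big => [k|k _].
  rewrite mem_cycle; apply/eqP/val_inj; rewrite /= cycle_perm_expE /=.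
  by rewrite addnS -addSn addnC modnDr modn_small.
rewrite -(big_map (fun i => x ((c ^+ k.+1)%g i)) xpredT F) /index_enum -enumT.
congr (\big[_/_]_(z <- _) _); rewrite /codom /image_mem -map_rot.
rewrite (map_comp x); congr map; apply: (inj_map val_inj).
rewrite map_rot val_enum_ord -map_comp.
apply: (@eq_from_nth _ 0%N) => [|i]; rewrite size_map size_enum_ord;
  rewrite ?size_rot ?size_iota // => lt_i.
rewrite (nth_map ord0) ?size_enum_ord //= cycle_perm_expE /= nth_enum_ord //.
rewrite -[0%N :: _]/(iota 0 n.+1) /rot nth_cat size_drop size_iota nth_drop.
have := ltn_ord k; rewrite leq_eqVlt => /orP[/eqP kn|lt_k].
  by rewrite kn subnn ltn0 subn0 nth_take ?nth_iota // modnDr modn_small.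
case: ltnP => [lt_ik|le_ik].
  by rewrite nth_iota ?modn_small //; lia.
rewrite nth_take; last lia.
rewrite nth_iota; last lia.
have -> : (i + k.+1 = (i - (n.+1 - k.+1)) + n.+1)%N by lia.
by rewrite modnDr modn_small ?add0n //; lia.
Qed.

End CyclicSum.

(** * The cyclic generators take scalar values *)

Lemma surjective_bij (T : finType) (f : T -> T) :
  (forall y, exists x, f x = y) -> bijective f.
Proof.
move=> f_surj; have [g fgK] := choice f_surj.
have {}fgK : cancel g f := fgK.
have g_bij : bijective g by apply: injF_bij; exact: can_inj fgK.
exact: (bij_can_bij g_bij).
Qed.

Section CyclicScalar.
Variables (K : idomainType) (n : nat).
Implicit Types (p q : int) (w : seq var).

Lemma residueE p : (residue n p : nat)%:Z = (p %% n.+1%:Z)%Z.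
Proof. by rewrite /residue /= modn_small; lia. Qed.

Lemma residue_eq p q :
  residue n p = residue n q <-> (p %% n.+1%:Z)%Z = (q %% n.+1%:Z)%Z.
Proof.
rewrite -!residueE; split=> [->//|/eqP].
by rewrite eqz_nat => /eqP; apply: val_inj.
Qed.

Lemma residueD p q : residue n (p + q) = residue n p + residue n q.
Proof.
apply/val_inj/eqP; rewrite -eqz_nat residueE /= -modz_nat PoszD !residueE.
by rewrite modzDm.
Qed.

Lemma residue0 : residue n 0 = 0.
Proof. by apply/val_inj/eqP; rewrite -eqz_nat residueE mod0z. Qed.

Lemma residue_ord (i : 'I_n.+1) : residue n i%:Z = i.
Proof.
by apply/val_inj/eqP; rewrite -eqz_nat residueE modz_small // ltz_nat ltn_ord.
Qed.

Lemma residue_sum (I : Type) (r : seq I) (P : pred I) (d : I -> int) :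
  \sum_(i <- r | P i) residue n (d i) = residue n (\sum_(i <- r | P i) d i).
Proof. by rewrite (big_morph _ residueD residue0). Qed.

Lemma in_range_residue_inj p q : in_range n p -> in_range n q ->
  residue n p = residue n q -> p = q.
Proof.
by rewrite /in_range residue_eq => p_in q_in; rewrite !modz_small; lia.
Qed.

Lemma deg_take_codom (x : 'I_n.+1 -> var) (k : 'I_n.+1) :
  deg (take k.+1 (codom x)) = \sum_(i < n.+1 | (i <= k)%N) alpha (x i).
Proof.
rewrite /deg (big_nth (x ord0)) big_mkord size_take size_codom card_ord.
have -> : (if (k.+1 < n.+1)%N then k.+1 else n.+1) = k.+1.
  by case: ifP; move: (ltn_ord k); lia.
rewrite (@big_ord_widen _ _ _ k.+1 n.+1
  (fun i => alpha (nth (x ord0) (take k.+1 (codom x)) i))) //.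
apply: eq_big => // i; rewrite ltnS => ik; congr alpha.
by rewrite nth_take // (nth_map ord0) ?size_enum_ord // nth_ord_enum.
Qed.

(** Completeness in terms of the walk spelled by the word x_0 ... x_n: it is
    closed modulo n + 1 and its vertices represent all residues. *)
Lemma complete_sequenceP (x : 'I_n.+1 -> var) :
  complete_sequence (fun i => residue n (alpha (x i))) <->
  residue n (deg (codom x)) = 0 /\
  forall i : 'I_n.+1,
    exists k : 'I_n.+1, residue n (deg (take k.+1 (codom x))) = i.
Proof.
have degx : deg (codom x) = \sum_i alpha (x i) by rewrite /deg big_map big_enum.
rewrite /complete_sequence residue_sum degx; split=> -[-> cover]; split=> //.
  move=> i; have : [set: 'I_n.+1] i by [].
  by rewrite -cover => -[k _ <-]; exists k; rewrite deg_take_codom residue_sum.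
apply/seteqP; split=> // i _; have [k <-] := cover i.
by exists k => //; rewrite deg_take_codom residue_sum.
Qed.

Lemma scalar_mxE (A : 'M[K]_n.+1) : (forall i j, i != j -> A i j = 0) ->
  (forall i j, A i i = A j j) -> exists c, A = c%:M.
Proof.
move=> offdiag diag; exists (A 0 0); apply/matrixP => i j; rewrite mxE.
by case: eqVneq => [<-|/offdiag->//]; rewrite mulr1n.
Qed.

(** The k-th rotation of w, started at i, is the closed walk w started at
    i - s k.  A translate of w that stays in range meets each vertex of
    {0, ..., n} once; so it contributes the same product F to the
    diagonal entries at i and at j, through the rotations k and k' with
    s k' - s k = j - i.  The permutation pi h matches these rotations. *)
Lemma cyclic_sum_scalar (a : var * int -> K) (x : 'I_n.+1 -> var) :
  complete_sequence (fun i => residue n (alpha (x i))) ->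
  exists c, \sum_(s in Hgroup n) \prod_(i < n.+1)
              weighted_mx n a (x (s i)) = c%:M.
Proof.
case/complete_sequenceP; set w := codom x => w0 cover.
have size_w : size w = n.+1 by rewrite size_codom card_ord.
rewrite sum_Hgroup -/w; pose s (k : 'I_n.+1) := deg (take k.+1 w).
pose inside p := all (in_range n \o target) (edges p w).
pose F p := if inside p then \prod_(e <- edges p w) a e else 0.
have entry i j (k : 'I_n.+1) : (\prod_(z <- rot k.+1 w) weighted_mx n a z) i j =
    if (i == j) && (deg w == 0) then F (i%:Z - s k) else 0.
  rewrite word_entry deg_rot.
  have [ij|ij] := eqVneq (i%:Z + deg w) j%:Z; last first.
    rewrite andbF; case: eqVneq => //= eij; case: eqVneq => // dw.
    by rewrite eij dw addr0 eqxx in ij.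
  have eq_ij : i = j.
    apply/val_inj/eqP; rewrite -eqz_nat; apply/eqP.
    apply: in_range_residue_inj; rewrite ?ord_in_range //.
    by rewrite -ij residueD w0 addr0.
  rewrite eq_ij in ij *; have dw : deg w = 0 by lia.
  rewrite eqxx dw eqxx /= andbT /F /inside.
  have := edges_rot (j%:Z - s k) k.+1 dw; rewrite subrK => E.
  by rewrite /valid ord_in_range /= (perm_all _ E) (perm_big _ E).
apply: scalar_mxE => [i j /negbTE ij|i j].
  by rewrite summxE big1 // => k _; rewrite entry ij.
rewrite !summxE; under eq_bigr do rewrite entry eqxx /=.
under [RHS]eq_bigr do rewrite entry eqxx /=.
case: eqP => [dw|_]; last by rewrite !big1.
pose b k := residue n (s k).
have [b' bK b'K] : bijective b.
  by apply: surjective_bij => r; have [k <-] := cover r; exists k.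
pose pi (h : 'I_n.+1) k := b' (b k + h).
have piK h : cancel (pi h) (pi (- h)) by move=> k; rewrite /pi b'K addrK bK.
pose h := residue n j%:Z - residue n i%:Z.
(* A vertex of a walk in range is determined by its residue. *)
have step p q (k' : 'I_n.+1) : in_range n q -> inside p ->
    residue n (p + s k') = residue n q -> p + s k' = q.
  move=> q_in /allP p_in; apply: in_range_residue_inj => //.
  have [|e e_in <-] := @target_take p w k'; last exact: p_in.
  by rewrite size_w.
rewrite [RHS](reindex_inj (can_inj (piK h))) /=; apply: eq_bigr => k _.
have hE : residue n (s (pi h k)) =
    residue n (s k) + (residue n j%:Z - residue n i%:Z).
  by rewrite -/(b _) b'K.
have resB p q : residue n (p - q) = residue n p - residue n q.
  by apply/eqP; rewrite eq_sym subr_eq -residueD subrK.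
rewrite /F; case: ifP => [i_in|i_out]; last case: ifP => // j_in.
  have jE : i%:Z - s k + s (pi h k) = j%:Z.
    apply: step => //; first exact: ord_in_range.
    by rewrite residueD resB hE addrA subrK addrC subrK.
  have -> : j%:Z - s (pi h k) = i%:Z - s k by lia.
  by rewrite i_in.
suff jE : j%:Z - s (pi h k) + s k = i%:Z.
  by rewrite (_ : j%:Z - s (pi h k) = i%:Z - s k) ?i_out // in j_in; lia.
apply: step => //; first exact: ord_in_range.
rewrite residueD resB hE; set r := residue n (s k).
by rewrite opprD opprB addrA addrAC subrK addrC subrK.
Qed.

End CyclicScalar.

(** * Central polynomials form a TZ-space *)

Section CentralTZspace.
Variables (K : idomainType) (n : nat).
Implicit Types (f g : freeAlg K) (v : var -> 'M[K]_n.+1) (u w : seq var).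

(** Central polynomials without the condition at 0; this is what the generators
    satisfy in every order. *)
Definition scalar_valued : set (freeAlg K) :=
  [set f | forall v, graded_valuation v -> exists c, eval v f = c%:M].

Lemma central_polynomialsE :
  central_polynomials n = scalar_valued `&` zero_at_zero n.
Proof.
apply/seteqP; split=> f [].
  by move=> f0 f_central; split=> // v /f_central /central_scalarP.
by move=> f_scalar f0; split=> // v /f_scalar /central_scalarP.
Qed.

Lemma graded_valuation0 : graded_valuation (fun=> 0 : 'M[K]_n.+1).
Proof. by move=> x i j; rewrite mxE eqxx. Qed.

Lemma eval_homogeneous v d f :
  graded_valuation v -> homogeneous d f -> mx_component d (eval v f).
Proof.
move=> /graded_weighted[a ->] f_hom i j; apply: contra_neq_eq => jid.
rewrite eval_entry big_seq big1 // => m /f_hom md.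
have {}md : deg m = d by [].
by case: ifP => [/andP[_ /eqP]|_]; [lia | rewrite mulr0].
Qed.

Lemma hvar_homogeneous x : homogeneous (alpha x) (hvar K x).
Proof.
move=> m; rewrite /hvar msuppU1 inE => /eqP->.
by rewrite /mon_alpha fmU big_seq1.
Qed.

Lemma graded_endo_valuation v (phi : {lrmorphism freeAlg K -> freeAlg K}) :
  graded_valuation v -> graded_endo phi ->
  graded_valuation (fun x => eval v (phi (hvar K x))).
Proof.
move=> v_gr phi_gr x; apply: eval_homogeneous => //.
by apply: phi_gr; exists (hvar K x) => //; apply: hvar_homogeneous.
Qed.

Lemma scalar_valued_TZspace : TZspace scalar_valued.
Proof.
split.
- by move=> v _; exists 0; rewrite eval0 raddf0.
- move=> f g fD gD v v_gr; have [[c fE] [d gE]] := (fD v v_gr, gD v v_gr).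
  by exists (c + d); rewrite evalD fE gE raddfD.
- move=> c f fD v v_gr; have [d fE] := fD v v_gr.
  by exists (c * d); rewrite evalZ fE scale_scalar_mx.
- move=> d f fD v v_gr; have [c fE] := fD v v_gr.
  exists (if d == 0 then c else 0); apply/matrixP => i j.
  rewrite eval_hcomp // fE !mxE; have [<-|ij] := eqVneq i j.
    by rewrite subrr eq_sym; case: (d == 0).
  by rewrite !mulr0n if_same.
- move=> phi phi_gr f fD v v_gr; rewrite eval_endo.
  by apply: fD; apply: graded_endo_valuation.
Qed.

(** The commutator and reversal identities are instances of this. *)
Lemma same_edges_prod v u w : graded_valuation v ->
  (forall p, perm_eq (edges p u) (edges p w)) -> deg u = deg w ->
  \prod_(x <- u) v x = \prod_(x <- w) v x.
Proof.
move=> /graded_weighted[a ->] uw duw; apply/matrixP => i j.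
by rewrite !word_entry (perm_valid _ (uw _)) duw (perm_big _ (uw _)).
Qed.

Lemma central_gens_scalar : @central_gens K n `<=` scalar_valued.
Proof.
move=> f [[[]|]|].
- move=> [z1 [z2 [x1 [x2 [_ d1 d2 ->]]]]] v v_gr; exists 0.
  have comm :
    \prod_(x <- [:: x1; x2]) v x = \prod_(x <- [:: x2; x1]) v x.
    apply: same_edges_prod => [//|p|].
      apply: (@edges_arcs p [::] [:: x1] [:: x2] [::]);
        by rewrite !degE ?d1 ?d2.
    by rewrite !degE addrCA.
  rewrite !big_cons big_nil !mulr1 in comm.
  have -> : forall a b c d : freeAlg K, eval v (a * (b * c - c * b) * d) =
      eval v a * (eval v b * eval v c - eval v c * eval v b) * eval v d.
    by move=> a b c d; rewrite -!evalM -evalB -!evalM.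
  by rewrite !eval_hvar comm subrr mulr0 mul0r raddf0.
- move=> [z1 [z2 [x1 [x2 [x3 [_ d12 d23 _ ->]]]]]] v v_gr; exists 0.
  have rev :
    \prod_(x <- [:: x1; x2; x3]) v x = \prod_(x <- [:: x3; x2; x1]) v x.
    apply: same_edges_prod => [//|p|].
      apply: (@edges_arcs p [:: x1] [:: x2] [:: x3] [::]);
        by rewrite !degE; lia.
    by rewrite !degE; lia.
  rewrite !big_cons big_nil !mulr1 in rev.
  have -> : forall a b c d e : freeAlg K,
      eval v (a * (b * c * d - d * c * b) * e) = eval v a *
        (eval v b * (eval v c * eval v d) - eval v d * (eval v c * eval v b)) *
        eval v e.
    by move=> a b c d e; rewrite !mulrA -!evalM -evalB -!evalM.
  by rewrite !eval_hvar rev subrr mulr0 mul0r raddf0.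
- move=> [z1 [z2 [x1 [_ d1 ->]]]] v v_gr; exists 0.
  have -> : forall a b c : freeAlg K,
      eval v (a * b * c) = eval v a * eval v b * eval v c.
    by move=> a b c; rewrite -!evalM.
  rewrite !eval_hvar.
  suff -> : v x1 = 0 by rewrite mulr0 mul0r raddf0.
  apply/matrixP => i j; rewrite mxE; apply/eqP.
  apply: contraTT isT => /(v_gr x1).
  by move: (ltn_ord i) (ltn_ord j) d1; lia.
- move=> [x [_ x_complete _ ->]] v /graded_weighted[a ->].
  have [c cE] := cyclic_sum_scalar a x_complete; exists c.
  rewrite eval_sum -cE; apply: eq_bigr => s _.
  rewrite (big_morph _ (evalM _) (eval1 _)); apply: eq_bigr => i _.
  exact: eval_hvar.
Qed.

Lemma generated_scalar :
  TZspace_generated (@central_gens K n) `<=` scalar_valued.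
Proof. exact: smallest_sub scalar_valued_TZspace central_gens_scalar. Qed.

Lemma central_gens_zero_at_zero : @central_gens K n `<=` zero_at_zero n.
Proof.
have evalX x : eval (fun=> 0 : 'M[K]_n.+1) (hvar K x) = 0.
  exact: eval_hvar.
move=> f [[[]|]|]; rewrite /zero_at_zero /=.
- by move=> [z1 [z2 [x1 [x2 [_ _ _ ->]]]]]; rewrite !evalM evalX !mul0r.
- by move=> [z1 [z2 [x1 [x2 [x3 [_ _ _ _ ->]]]]]]; rewrite !evalM evalX !mul0r.
- by move=> [z1 [z2 [x1 [_ _ ->]]]]; rewrite !evalM evalX !mul0r.
- move=> [x [_ _ _ ->]]; rewrite eval_sum big1 // => s _.
  by rewrite (big_morph _ (evalM _) (eval1 _)) big_ord_recl evalX mul0r.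
Qed.

Lemma eval_diag v (d : var -> 'rV[K]_n.+1) f i :
  (forall x, v x = diag_mx (d x)) ->
  eval v f i i = \sum_(m <- msupp f) f@_m * \prod_(x <- m) d x 0 i.
Proof.
move=> vE; rewrite evalE summxE; apply: eq_bigr => m _.
rewrite mxE; congr (_ * _).
suff -> : \prod_(x <- m) v x = diag_mx (\row_k \prod_(x <- m) d x 0 k).
  by rewrite !mxE eqxx.
elim: (m : seq var) => [|x w IH].
  by rewrite big_nil; apply/matrixP => k l; rewrite !mxE big_nil.
rewrite big_cons IH vE -mulmxE mulmx_diag; congr diag_mx.
by apply/rowP => k; rewrite !mxE big_cons.
Qed.

Lemma eval_zero f :
  eval (fun=> 0 : 'M[K]_n.+1) f = (f@_(FMonom [::]))%:M.
Proof.
rewrite [in RHS](monalgE f) !raddf_sum evalE /=; apply: eq_bigr => m _.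
rewrite mcoeffU fmP -mul_scalar_mx.
case: (m : seq var) => [|x w].
  by rewrite big_nil mulmx1 mulr1n.
by rewrite big_cons mul0r mulmx0 mulr0n raddf0.
Qed.

Lemma zero_at_zeroP f : zero_at_zero n f <-> f@_(FMonom [::]) = 0.
Proof.
rewrite /zero_at_zero /= eval_zero.
by split=> [/matrixP/(_ 0 0)|->]; rewrite ?raddf0 // !mxE eqxx.
Qed.

(** The delicate point is that an endomorphism phi may move a variable of degree
    0 to a polynomial with nonzero constant term.  Substituting these constants
    in f gives a scalar c.  If they are placed only at the
    diagonal position (0, 0), the valuation is still graded, and the value of f
    has c at (0, 0) and the value of f at 0, which is 0, at (n, n).  As that
    value is scalar, c = 0. *)
Lemma central_TZspace : (0 < n)%N ->
  TZspace (scalar_valued `&` zero_at_zero n : set (freeAlg K)).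
Proof.
move=> n_gt0; have [D0 DD DZ Dgr Dendo] := scalar_valued_TZspace.
split.
- by split=> //; apply: eval0.
- move=> f g [fD f0] [gD g0]; split; first exact: DD.
  by rewrite /zero_at_zero /= evalD f0 g0 addr0.
- move=> c f [fD f0]; split; first exact: DZ.
  by rewrite /zero_at_zero /= evalZ f0 scaler0.
- move=> d f [fD f0]; split; first exact: Dgr.
  apply/matrixP => i j; rewrite eval_hcomp; last exact: graded_valuation0.
  by rewrite f0 mxE if_same.
move=> phi phi_gr f [fD f0]; split; first exact: Dendo.
have zero_gr := graded_valuation0.
have [c fE] := Dendo phi phi_gr f fD _ zero_gr.
rewrite /zero_at_zero /= fE (_ : c = 0) ?raddf0 //.
rewrite eval_endo in fE.
pose v0 x := eval (fun=> 0 : 'M[K]_n.+1) (phi (hvar K x)).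
have v0E x : v0 x = diag_mx (const_mx (v0 x 0 0)).
  by rewrite diag_const_mx /v0 eval_zero mxE eqxx.
(* The constant terms of the images, placed at the position (0, 0) only. *)
pose d x : 'rV[K]_n.+1 := \row_k (if k == 0 then v0 x 0 0 else 0).
pose v x := diag_mx (d x).
have v_gr : graded_valuation v.
  move=> x i j; rewrite !mxE.
  have [<-|_] := eqVneq i j; last by rewrite eqxx.
  have [->|_] := eqVneq i 0; last by rewrite eqxx.
  rewrite mulr1n.
  exact: (graded_endo_valuation zero_gr phi_gr).
have [e vE] := fD v v_gr.
have e0 : e = 0.
  have /(congr1 (fun A : 'M_n.+1 => A ord_max ord_max)) := vE.
  rewrite (eval_diag (d := d)) // mxE eqxx mulr1n => <-.
  have := congr1 (fun A : 'M_n.+1 => A ord_max ord_max) f0.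
  rewrite (eval_diag (d := fun=> 0)) => [|x]; last by rewrite raddf0.
  rewrite [RHS]mxE => E; rewrite -[RHS]E.
  apply: eq_bigr => m _; congr (_ * _); apply: eq_bigr => x _.
  by rewrite !mxE -val_eqE /= eqn0Ngt n_gt0.
have /(congr1 (fun A : 'M_n.+1 => A 0 0)) := vE.
rewrite e0 (eval_diag (d := d)) // !mxE mul0rn => <-.
have /(congr1 (fun A : 'M_n.+1 => A 0 0)) := fE.
rewrite (eval_diag _ _ v0E) [RHS]mxE eqxx mulr1n => <-.
apply: eq_bigr => m _; congr (_ * _); apply: eq_bigr => x _.
by rewrite !mxE eqxx.
Qed.

End CentralTZspace.

(** * Consequences of the generators on words *)

Section Substitution.
Variables (K : idomainType) (sigma : var -> seq var).

Definition word_subst (f : freeAlg K) : freeAlg K :=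
  mmap (@malgC {fmonom var} K)
    (fun m : {fmonom var} => word K (flatten (map sigma m))) f.

Lemma word_subst_monomial c m :
  word_subst << c *g m >> = c *: word K (flatten (map sigma m)).
Proof. by rewrite /word_subst mmapU mul_malgC. Qed.

Lemma word_substE f :
  word_subst f = \sum_(m <- msupp f) f@_m *: word K (flatten (map sigma m)).
Proof. by apply: eq_bigr => m _; rewrite mul_malgC. Qed.

Lemma word_subst_additive : additive word_subst.
Proof. exact: mmap_is_additive. Qed.

HB.instance Definition _ :=
  GRing.isAdditive.Build (freeAlg K) (freeAlg K) word_subst word_subst_additive.

Lemma word_subst_multiplicative : multiplicative word_subst.
Proof.
split=> [f g|]; last by rewrite word_subst_monomial scale1r fm1 word_nil.
rewrite malgME raddf_sum [word_subst f]word_substE mulr_suml.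
apply: eq_bigr => k _.
rewrite raddf_sum [word_subst g]word_substE mulr_sumr; apply: eq_bigr => l _.
rewrite /= word_subst_monomial fmM map_cat flatten_cat.
rewrite !scale_word malgM_def fgmulUU.
by congr << _ *g _ >>; apply/eqP; rewrite fmP fmM.
Qed.

HB.instance Definition _ :=
  GRing.isMultiplicative.Build (freeAlg K) (freeAlg K) word_subst
    word_subst_multiplicative.

Lemma word_subst_scalable : scalable word_subst.
Proof.
move=> c f; rewrite [in LHS](malg_words f) scaler_sumr raddf_sum.
rewrite word_substE scaler_sumr; apply: eq_bigr => m _.
rewrite [RHS]scalerA /=.
have -> : c *: (f@_m *: word K m) = << c * f@_m *g m >>.
  by rewrite (scalerA c f@_m (word K m)) scale_word fmK.
exact: word_subst_monomial.
Qed.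

HB.instance Definition _ :=
  GRing.isScalable.Build K (freeAlg K) (freeAlg K) *:%R word_subst
    word_subst_scalable.

Lemma word_subst_hvar x : word_subst (hvar K x) = word K (sigma x).
Proof. by rewrite word_subst_monomial scale1r fmU /= cats0. Qed.

Hypothesis deg_sigma : forall x, deg (sigma x) = alpha x.

Lemma deg_flatten_sigma w : deg (flatten (map sigma w)) = deg w.
Proof. by elim: w => //= x w IH; rewrite deg_cat deg_cons deg_sigma IH. Qed.

Lemma word_subst_graded : graded_endo word_subst.
Proof.
move=> d _ [f f_hom <-] m; apply: contraTeq => md.
rewrite -mcoeff_eq0 /= word_substE raddf_sum big_seq big1 // => k /f_hom kd.
rewrite scale_word /= mcoeffU; case: (FMonom _ =P m) => [mE|//].
by case/eqP: md; rewrite -mE -kd; apply: deg_flatten_sigma.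
Qed.

End Substitution.

Section RingMorphisms.
Variables (R S : nzRingType) (phi : {rmorphism R -> S}).

Lemma rmorph_sandwich x y z a b c :
  phi x = a -> phi y = b -> phi z = c -> phi (x * y * z) = a * (b * c).
Proof. by move=> <- <- <-; rewrite !rmorphM mulrA. Qed.

Lemma rmorph_commutator x y z t a b c d :
  phi x = a -> phi y = b -> phi z = c -> phi t = d ->
  phi (x * (y * z - z * y) * t) =
  a * (b * (c * d)) - a * (c * (b * d)).
Proof.
by move=> <- <- <- <-; rewrite !rmorphM rmorphB !rmorphM mulrBr mulrBl !mulrA.
Qed.

Lemma rmorph_reversal x y z r t a b c d e :
  phi x = a -> phi y = b -> phi z = c -> phi r = d -> phi t = e ->
  phi (x * (y * z * r - r * z * y) * t) =
  a * (b * (c * (d * e))) - a * (d * (c * (b * e))).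
Proof.
move=> <- <- <- <- <-.
by rewrite !rmorphM rmorphB !rmorphM mulrBr mulrBl !mulrA.
Qed.

End RingMorphisms.

Section GeneratedSpace.
Variables (K : idomainType) (n : nat).
Local Notation V := (TZspace_generated (@central_gens K n)).
Implicit Types (u v w a b : seq var) (ws : seq (seq var)).

Lemma generated_TZspace : TZspace V.
Proof.
split=> [|f g fV gV|c f fV|d f fV|phi phi_gr f fV] W [W_TZ W_gens].
- exact: TZspace0.
- by apply: TZspaceD => //; [apply: fV | apply: gV].
- by apply: TZspaceZ => //; apply: fV.
- by apply: TZspace_graded => //; apply: fV.
- by apply: TZspace_endo => //; apply: fV.
Qed.

Lemma generated_gens f : central_gens n f -> V f.
Proof. by move=> f_gen W [_]; apply. Qed.

Lemma generatedB f g : V f -> V g -> V (f - g).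
Proof.
move=> fV gV; have TZ := generated_TZspace.
by apply: (TZspaceD TZ) => //; rewrite -scaleN1r; apply: (TZspaceZ TZ).
Qed.

Lemma generated_sum (I : Type) (r : seq I) (P : pred I) (F : I -> freeAlg K) :
  (forall i, P i -> V (F i)) -> V (\sum_(i <- r | P i) F i).
Proof.
move=> FV; have TZ := generated_TZspace.
by apply: big_ind => //; [apply: TZspace0 | apply: TZspaceD].
Qed.

(** The k-th variable of the degree of the k-th word of ws; the index k keeps
    slots distinct when degrees coincide. *)
Definition slot ws k : var := (deg (nth [::] ws k), k).
(** The substitution that puts in each slot the corresponding word.  Other
    variables are kept; an index beyond the list stands for the empty word,
    which has the degree 0 of its slot. *)
Definition fill ws (x : var) : seq var :=
  if x.1 == deg (nth [::] ws x.2) then nth [::] ws x.2 else [:: x].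

Lemma uniq_slots ws ks : uniq ks -> uniq (map (slot ws) ks).
Proof. by rewrite map_inj_uniq // => i j []. Qed.

Lemma fill_slot ws k : fill ws (slot ws k) = nth [::] ws k.
Proof. by rewrite /fill eqxx. Qed.

Lemma deg_fill ws x : deg (fill ws x) = alpha x.
Proof.
by rewrite /fill; case: ifP => [/eqP<-//|_]; rewrite !degE addr0.
Qed.

Lemma generated_fill ws f : V f -> V (word_subst (fill ws) f).
Proof.
apply: (TZspace_endo generated_TZspace).
exact: word_subst_graded (deg_fill ws).
Qed.

Lemma word_subst_slot ws k :
  word_subst (fill ws) (hvar K (slot ws k)) = word K (nth [::] ws k).
Proof. by rewrite word_subst_hvar fill_slot. Qed.

Lemma generated_swap a u v b : deg u = 0 -> deg v = 0 ->
  V (word K (a ++ u ++ v ++ b) - word K (a ++ v ++ u ++ b)).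
Proof.
move=> u0 v0; pose ws := [:: a; b; u; v].
have gen : central_gens n (hvar K (slot ws 0) *
    (hvar K (slot ws 2) * hvar K (slot ws 3)
     - hvar K (slot ws 3) * hvar K (slot ws 2))
    * hvar K (slot ws 1)).
  left; left; left.
  exists (slot ws 0), (slot ws 1), (slot ws 2), (slot ws 3).
  by split=> //; exact: (@uniq_slots ws [:: 0; 1; 2; 3]%N).
move: (generated_fill ws (generated_gens gen)).
rewrite (rmorph_commutator (word_subst_slot ws 0) (word_subst_slot ws 2)
  (word_subst_slot ws 3) (word_subst_slot ws 1)).
by rewrite !word_cat.
Qed.

Lemma generated_rev a u v w b : deg u = - deg v -> deg w = - deg v ->
  deg v != 0 ->
  V (word K (a ++ u ++ v ++ w ++ b) - word K (a ++ w ++ v ++ u ++ b)).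
Proof.
move=> uv wv v0; pose ws := [:: a; b; u; v; w].
have gen : central_gens n (hvar K (slot ws 0) *
    (hvar K (slot ws 2) * hvar K (slot ws 3) * hvar K (slot ws 4)
     - hvar K (slot ws 4) * hvar K (slot ws 3) * hvar K (slot ws 2))
    * hvar K (slot ws 1)).
  left; left; right.
  exists (slot ws 0), (slot ws 1), (slot ws 2), (slot ws 3), (slot ws 4).
  split; last by [].
  - exact: (@uniq_slots ws [:: 0; 1; 2; 3; 4]%N).
  - by rewrite /alpha /=; lia.
  - by rewrite /alpha /=; lia.
  - by rewrite /alpha /=; lia.
move: (generated_fill ws (generated_gens gen)).
rewrite (rmorph_reversal (word_subst_slot ws 0) (word_subst_slot ws 2)
  (word_subst_slot ws 3) (word_subst_slot ws 4) (word_subst_slot ws 1)).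
by rewrite !word_cat.
Qed.

Lemma generated_large a u b : n.+1%:Z <= `|deg u| -> V (word K (a ++ u ++ b)).
Proof.
move=> u_large; pose ws := [:: a; b; u].
have gen : central_gens n
    (hvar K (slot ws 0) * hvar K (slot ws 2) * hvar K (slot ws 1)).
  by left; right; exists (slot ws 0), (slot ws 1), (slot ws 2);
    split=> //; exact: (@uniq_slots ws [:: 0; 1; 2]%N).
move: (generated_fill ws (generated_gens gen)).
rewrite (rmorph_sandwich (word_subst_slot ws 0) (word_subst_slot ws 2)
  (word_subst_slot ws 1)).
by rewrite !word_cat.
Qed.

Lemma shuffle_generated u v : shuffle u v -> V (word K u - word K v).
Proof.
elim=> [w|v' u' w _ uvV _ vwV|a u' v' b u0 v0|a u' v' w b uv wv v0].
- by rewrite subrr; apply: TZspace0 generated_TZspace.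
- have <- : word K u' - word K v' + (word K v' - word K w) =
      word K u' - word K w by exact: subrKA.
  exact: (TZspaceD generated_TZspace).
- exact: generated_swap.
- exact: generated_rev.
Qed.

Lemma rotations_generated (ys : 'I_n.+1 -> seq var) :
  complete_sequence (fun i => residue n (deg (ys i))) ->
  (forall i, `|deg (ys i)| < n.+1%:Z) ->
  V (\sum_(k < n.+1) word K (flatten (rot k.+1 (codom ys)))).
Proof.
move=> ys_complete ys_small; pose ws := codom ys.
have nth_ws (i : 'I_n.+1) : nth [::] ws i = ys i.
  rewrite /ws /codom /image_mem (nth_map ord0) ?size_enum_ord //.
  by rewrite nth_ord_enum.
have gen : central_gens n
    (\sum_(s in Hgroup n) \prod_(i < n.+1) hvar K (slot ws (s i))).
  right; exists (fun i : 'I_n.+1 => slot ws i); split=> //.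
  - by move=> i j [_ /val_inj].
  - by rewrite (_ : (fun i => _) = (fun i => residue n (deg (ys i)))) //;
      apply: funext => i; rewrite /alpha /= nth_ws.
  - by move=> i; rewrite /alpha /= nth_ws.
move: (generated_fill ws (generated_gens gen)).
rewrite rmorph_sum /=.
under eq_bigr => s _.
  rewrite rmorph_prod /=.
  under eq_bigr => i _ do rewrite word_subst_slot nth_ws.
  over.
rewrite (sum_Hgroup ys (word K)).
by under [X in _ -> V X]eq_bigr => k _ do rewrite word_flatten.
Qed.

End GeneratedSpace.

(** * Closed walks through all vertices *)

Section ClosedWalks.
Variables (K : idomainType) (n : nat).
Local Notation V := (TZspace_generated (@central_gens K n)).
Implicit Types (u v w : seq var) (p : int).

(** Cutting w where it first visits each vertex gives n + 1 blocks whose end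
    points are distinct modulo n + 1, hence a complete sequence of degrees.
    The rotations of these blocks are closed walks on the edges of w, one from
    each vertex, and each is a shuffle of the chosen walk M i from the same
    vertex. *)
Lemma closed_walks_generated p w (M : 'I_n.+1 -> seq var) :
  valid n p w -> deg w = 0 ->
  (forall i : 'I_n.+1, exists2 e, e \in edges p w & e.2 = i%:Z) ->
  (forall i : 'I_n.+1, perm_eq (edges i%:Z (M i)) (edges p w)) ->
  V (\sum_(i < n.+1) word K (M i)).
Proof.
move=> w_valid w0 cover MP.
have [ys [ysw ys_uniq ysE]] := first_visit_blocks p w.
have starts_ord q :
    q \in starts p ys = (q \in [seq (nat_of_ord i)%:Z | i <- enum 'I_n.+1]).
  rewrite ysE; apply/mapP/mapP => -[].
    move=> e /(valid_source w_valid) /in_range_ord[i eE] qe.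
    by exists i; rewrite ?mem_enum // qe.
  by move=> i _ ->; have [e] := cover i; exists e.
have size_ys : size ys = n.+1.
  rewrite -(size_starts p) (perm_size (uniq_perm ys_uniq _ starts_ord)).
    by rewrite size_map size_enum_ord.
  by rewrite map_inj_uniq ?enum_uniq // => i j [/val_inj].
pose pos k := p + deg (flatten (take k ys)).
have pos_last : pos n.+1 = p.
  by rewrite /pos take_oversize ?size_ys // ysw w0 addr0.
have pos_start k : (k < n.+1)%N -> pos k \in starts p ys.
  move=> lt_k; rewrite /pos -(nth_starts 0) ?size_ys // mem_nth //.
  by rewrite size_starts size_ys.
have start_in q : q \in starts p ys -> in_range n q.
  by rewrite starts_ord => /mapP[i _ ->]; apply: ord_in_range.
have pos_in k : (k <= n.+1)%N -> in_range n (pos k).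
  rewrite leq_eqVlt => /orP[/eqP->|/pos_start/start_in//].
  by rewrite pos_last; case/andP: w_valid.
have pos_surj (i : 'I_n.+1) : exists k : 'I_n.+1, pos k.+1 = i%:Z.
  have : i%:Z \in starts p ys by rewrite starts_ord map_f // mem_enum.
  case/(nthP 0) => -[|k]; rewrite size_starts size_ys => lt_k;
    rewrite nth_starts ?size_ys // => <-.
    (* The vertex where w starts is the end of the last block. *)
    by exists ord_max; rewrite pos_last take0 deg_nil addr0.
  by exists (Ordinal (ltnW lt_k)).
pose Y (i : 'I_n.+1) := nth [::] ys i.
have YE : codom Y = ys.
  apply: (@eq_from_nth _ [::]) => [|k];
    rewrite size_codom card_ord ?size_ys // => lt_k.
  by rewrite (nth_map ord0) ?size_enum_ord // /Y nth_enum_ord.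
pose x (i : 'I_n.+1) := slot ys i.
have degx k : deg (take k (codom x)) = deg (flatten (take k ys)).
  rewrite -YE /codom /image_mem -!map_take.
  by elim: (take k _) => //= i s IH; rewrite deg_cat deg_cons IH.
have pos_nat (k : 'I_n.+1) : exists i : 'I_n.+1, pos k.+1 = i%:Z.
  by apply: in_range_ord; apply: pos_in.
have [start startE] := choice pos_nat.
have start_bij : bijective start.
  apply: surjective_bij => i; have [k kE] := pos_surj i; exists k.
  by apply/val_inj/eqP; rewrite -eqz_nat -startE kE.
have rotations : V (\sum_(k < n.+1) word K (flatten (rot k.+1 ys))).
  rewrite -YE; apply: rotations_generated.
    apply/(@complete_sequenceP n x); split.
      rewrite -[codom x]take_size degx size_codom card_ord.
      by rewrite take_oversize ?size_ys // ysw w0 residue0.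
    move=> i; have [k kE] := pos_surj (residue n (i%:Z + p)); exists k.
    rewrite degx; apply: (addIr (residue n p)).
    by rewrite -residueD addrC -/(pos _) kE residue_ord residueD residue_ord.
  move=> i; have := (pos_in i.+1 (ltn_ord i)).
  have := pos_in i (ltnW (ltn_ord i)).
  have -> : pos i.+1 = pos i + deg (Y i).
    rewrite /pos (take_nth [::]) ?size_ys // -cats1 flatten_cat /= cats0.
    by rewrite deg_cat addrA.
  by rewrite /in_range; lia.
rewrite (reindex start) /=; last exact: onW_bij.
have -> : \sum_(k < n.+1) word K (M (start k)) =
    \sum_(k < n.+1) word K (flatten (rot k.+1 ys)) -
    \sum_(k < n.+1) (word K (flatten (rot k.+1 ys)) - word K (M (start k))).
  by rewrite sumrB opprB addrC subrK.
apply: generatedB => //; apply: generated_sum => k _.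
apply: shuffle_generated; apply: (@same_edges_shuffle (pos k.+1)).
rewrite [in X in perm_eq _ X]startE perm_sym; apply: perm_trans (MP _) _.
rewrite perm_sym; set y := flatten (take k.+1 ys).
have wE : w = y ++ flatten (drop k.+1 ys).
  by rewrite -flatten_cat cat_take_drop.
have -> : flatten (rot k.+1 ys) = rot (size y) w.
  by rewrite [in RHS]wE rot_size_cat /rot flatten_cat.
have -> : pos k.+1 = p + deg (take (size y) w) by rewrite wE take_size_cat.
exact: edges_rot.
Qed.

End ClosedWalks.

(** * Central polynomials are generated *)

Section Reduction.
Variables (K : idomainType) (n : nat).
Hypothesis K_inf : infinite_set [set: K].
Local Notation V := (TZspace_generated (@central_gens K n)).
Implicit Types (f g : freeAlg K) (m : {fmonom var}).

Definition entry_coef f (i j : 'I_n.+1) m : K :=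
  if valid n i%:Z m && (i%:Z + deg m == j%:Z) then f@_m else 0.

Lemma eval_entry_coef a f (i j : 'I_n.+1) : eval (weighted_mx n a) f i j =
  \sum_(m <- msupp f) entry_coef f i j m * \prod_(e <- edges i%:Z m) a e.
Proof.
rewrite eval_entry; apply: eq_bigr => m _.
by rewrite /entry_coef; case: ifP; rewrite ?mulr0 ?mul0r.
Qed.

(** This and the next lemma compare the coefficients of one monomial in the edge
    weights: in an off-diagonal entry, and in two diagonal entries. *)
Lemma scalar_offdiag f (i j : 'I_n.+1) E : scalar_valued n f -> i != j ->
  \sum_(m <- msupp f | perm_eq (edges i%:Z m) E) entry_coef f i j m = 0.
Proof.
move=> f_scalar ij; apply: (vanishing_coefficients K_inf) => a.
have [c fE] := f_scalar _ (@weighted_graded K n a).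
by rewrite -eval_entry_coef fE mxE (negbTE ij).
Qed.

Lemma scalar_diag f (i j : 'I_n.+1) E : scalar_valued n f ->
  \sum_(m <- msupp f | perm_eq (edges i%:Z m) E) entry_coef f i i m =
  \sum_(m <- msupp f | perm_eq (edges j%:Z m) E) entry_coef f j j m.
Proof.
move=> f_scalar; apply/eqP; rewrite -subr_eq0; apply/eqP.
(* The difference of the two entries, as one combination of monomials. *)
pose s := [seq (true, m) | m <- msupp f] ++ [seq (false, m) | m <- msupp f].
pose c (bm : bool * {fmonom var}) :=
  if bm.1 then entry_coef f i i bm.2 else - entry_coef f j j bm.2.
pose ed (bm : bool * {fmonom var}) := edges (if bm.1 then i%:Z else j%:Z) bm.2.
rewrite -sumrN.
have := @vanishing_coefficients _ _ _ K_inf s c ed E.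
rewrite /s big_cat !big_map /=; apply=> a.
rewrite big_cat !big_map /c /ed /=.
have [d fE] := f_scalar _ (@weighted_graded K n a).
transitivity (eval (weighted_mx n a) f i i - eval (weighted_mx n a) f j j).
  rewrite !eval_entry_coef -sumrN; congr (_ + _).
  by apply: eq_bigr => m _; rewrite mulNr.
by rewrite fE !mxE !eqxx subrr.
Qed.

(** One reduction step.  Either a word of f has no valid starting point, or two
    words of f have the same edges from 0, or the coefficients of
    distinct words cannot cancel in an entry of the value.  In the last case a
    word m, valid from i, must be closed and have a counterpart M k in f with
    the same edges from each vertex k. *)
Lemma generated_part f : central_polynomials n f -> f != 0 ->
  exists g, [/\ V g, {subset msupp g <= msupp f}
              & exists2 m, m \in msupp f & g@_m = 1].
Proof.
rewrite central_polynomialsE => -[f_scalar /zero_at_zeroP f1] f0.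
have wordE m : word K m = << m >> by rewrite /word fmK.
have supp_word m : m \in msupp f -> {subset msupp (word K m) <= msupp f}.
  by move=> mf k; rewrite wordE msuppU1 inE => /eqP->.
have [[m mf m_invalid]|valid_supp] :=
    EM (exists2 m, m \in msupp f & forall p, ~~ valid n p m).
  exists (word K m); split; [|exact: supp_word|].
    by have [a [u [b [-> /generated_large]]]] := invalid_infix m_invalid.
  by exists m => //; rewrite wordE mcoeffUU.
have [[m mf [m' m'f [mm' E]]]|edges_inj] := EM (exists2 m, m \in msupp f &
    exists2 m', m' \in msupp f & m != m' /\ perm_eq (edges 0 m) (edges 0 m')).
  exists (word K m - word K m'); split.
  - exact: shuffle_generated (same_edges_shuffle E).
  - move=> k /(fsubsetP (msuppB_le _ _)); rewrite in_fsetU.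
    by move=> /orP[] /supp_word; apply.
  - exists m => //; rewrite !wordE mcoeffB !mcoeffU eqxx eq_sym.
    by rewrite (negbTE mm') subr0.
have [m mf] : exists m, m \in msupp f.
  by apply/fset0Pn; rewrite msupp_eq0.
have m_uniq p m' : m' \in msupp f -> perm_eq (edges p m') (edges p m) -> m' = m.
  move=> m'f E; apply/eqP/negPn/negP => m'm; apply: edges_inj.
  by exists m' => //; exists m => //; split=> //; apply: perm_edges_shift E.
have [p m_valid] : exists p, valid n p m.
  apply: contrapT => m_invalid; apply: valid_supp; exists m => // p.
  by apply/negP => pm; apply: m_invalid; exists p.
have [i pE] : exists i : 'I_n.+1, p = i%:Z.
  by apply: in_range_ord; case/andP: m_valid.
have [j jE] := in_range_ord (valid_end m_valid); rewrite pE in m_valid jE.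
have coef_m : \sum_(m' <- msupp f | perm_eq (edges i%:Z m') (edges i%:Z m))
    entry_coef f i j m' = f@_m.
  rewrite big_mkcond (bigD1_seq m) ?fset_uniq //= ?perm_refl.
  rewrite /entry_coef m_valid jE eqxx /=.
  rewrite big_seq_cond big1 ?addr0 // => m' /andP[m'f m'm].
  by case: ifP => // /(m_uniq _ _ m'f) E; rewrite E eqxx in m'm.
have fm0 : f@_m != 0 by rewrite mcoeff_neq0.
have ij : i = j.
  apply/eqP; apply: contraNT fm0 => ij.
  by rewrite -coef_m scalar_offdiag.
rewrite -ij in jE coef_m.
have M_ex (k : 'I_n.+1) : exists m',
    m' \in msupp f /\ perm_eq (edges k%:Z m') (edges i%:Z m).
  apply: contrapT => no_m'; case/eqP: fm0.
  rewrite -coef_m (scalar_diag _ k) // big_seq_cond big1 // => m' /andP[m'f E].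
  by case: no_m'; exists m'.
have [M MP] := choice M_ex.
have m_neq0 : (m : seq var) != [::].
  apply: contraNneq fm0 => m0; rewrite -f1; apply/eqP; congr mcoeff.
  by apply/eqP; rewrite fmP m0.
have Mi : M i = m by have [Mf /(m_uniq _ _ Mf)] := MP i.
exists (\sum_k word K (M k)); split.
- apply: (closed_walks_generated (p := i%:Z) (w := m)) => // [|k|k].
  + by lia.
  + have [_ E] := MP k; case ME : (M k : seq var) E => [|x w] E.
      move: (perm_size E); rewrite !size_edges /= => /esym/size0nil/eqP.
      by rewrite (negbTE m_neq0).
    by exists (x, k%:Z) => //; rewrite -(perm_mem E) mem_head.
  + by have [] := MP k.
- move=> k; apply: contraTT => kf; rewrite -mcoeff_eq0 raddf_sum big1 // => l _.
  rewrite /= wordE mcoeffU; case: eqP => // lk.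
  by case/negP: kf; rewrite -lk; have [] := MP l.
- exists m => //; rewrite raddf_sum (bigD1 i) //= wordE Mi mcoeffUU.
  rewrite big1 ?addr0 // => k ki.
  rewrite wordE mcoeffU; case: eqP => // Mk; case/eqP: ki; apply/val_inj/eqP.
  rewrite -eqz_nat; apply/eqP; apply: (@edges_start_inj _ _ m) => //.
  by have [_] := MP k; rewrite Mk.
Qed.

Lemma central_generated f : central_polynomials n f -> V f.
Proof.
have [k] := ubnP #|` msupp f|; elim: k f => // k IH f lt_k f_central.
have [->|f0] := eqVneq f 0; first exact: (TZspace0 (generated_TZspace K n)).
have [g [gV gf [m mf gm]]] := generated_part f_central f0.
rewrite -[f](subrK (f@_m *: g)).
have fgV := TZspaceZ (generated_TZspace K n) f@_m gV.
apply: (TZspaceD (generated_TZspace K n)) => //; apply: IH.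
  rewrite -ltnS; apply: leq_trans lt_k.
  rewrite ltnS (cardfsD1 m (msupp f)) mf add1n ltnS.
  apply/fsubset_leq_card/fsubsetP => k' k'f; rewrite in_fsetD1.
  apply/andP; split.
    apply: contraTneq k'f => ->; rewrite -mcoeff_eq0 mcoeffB mcoeffZ gm mulr1.
    by rewrite subrr.
  have := fsubsetP (msuppB_le _ _) _ k'f; rewrite in_fsetU => /orP[//|].
  by move=> /(fsubsetP (msuppZ_le _ _))/gf.
move: f_central; rewrite !central_polynomialsE => -[f_scalar f_zero]; split.
  have [_ DD DZ _ _] := scalar_valued_TZspace K n.
  apply: (DD) => //; rewrite -scaleN1r; apply: (DZ); exact: generated_scalar.
apply/zero_at_zeroP; rewrite mcoeffB mcoeffZ.
have /zero_at_zeroP f1 := f_zero; rewrite f1 sub0r.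
suff -> : g@_(FMonom [::]) = 0 by rewrite mulr0 oppr0.
by apply/mcoeff_outdom/negP => /gf; rewrite -mcoeff_neq0 f1 eqxx.
Qed.

End Reduction.

Theorem theorem9p2 (K : idomainType) (n : nat)
    (K_infinite : infinite_set [set: K]) :
  ((1 < n.+1)%N ->
     central_polynomials n = TZspace_generated (@central_gens K n)) /\
  (n.+1 = 1%N ->
     central_polynomials n =
       TZspace_generated (@central_gens K n) `&` zero_at_zero n).
Proof.
split=> n1; apply/seteqP; split=> f.
- exact: central_generated.
- rewrite central_polynomialsE; apply: smallest_sub (central_TZspace K n1) _ f.
  move=> f f_gen; split; first exact: central_gens_scalar.
  exact: central_gens_zero_at_zero f_gen.
- move=> f_central; split; first exact: central_generated.
  by case: f_central.
- rewrite central_polynomialsE => -[/generated_scalar f_scalar f_zero].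
  by split.
Qed.
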